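(* The space $\mathrm{ARI}_{\underline{al}/\underline{al}}$ is a Lie algebra under the $ari$-bracket, i.e. it is closed under $ari$.
   Context: A mould $A$ is a family of functions $A(u_1,\dots,u_r)$, $r\ge0$; $\mathrm{ARI}$: moulds with $A(\emptyset)=0$. $mu(A,B)(u_1,\dots,u_r)=\sum_{i=0}^rA(u_1,\dots,u_i)B(u_{i+1},\dots,u_r)$, $limu(A,B)=mu(A,B)-mu(B,A)$. For $\mathbf w=(u_1,\dots,u_r)=\mathbf a\mathbf b\mathbf c$ with $\mathbf a=(u_1..u_k)$, $\mathbf b=(u_{k+1}..u_{k+l})$, $\mathbf c=(u_{k+l+1}..u_r)$: if $\mathbf b,\mathbf c\ne\emptyset$, $\mathbf a\lceil\mathbf c=(u_1,\dots,u_k,u_{k+1}+\dots+u_{k+l+1},u_{k+l+2},\dots,u_r)$; if $\mathbf a,\mathbf b\ne\emptyset$, $\mathbf a\rceil\mathbf c=(u_1,\dots,u_{k-1},u_k+\dots+u_{k+l},u_{k+l+1},\dots,u_r)$. $(arit(B)A)(\mathbf w)=\sum_{\mathbf w=\mathbf a\mathbf b\mathbf c,\,\mathbf b,\mathbf c\ne\emptyset}A(\mathbf a\lceil\mathbf c)B(\mathbf b)-\sum_{\mathbf w=\mathbf a\mathbf b\mathbf c,\,\mathbf a,\mathbf b\ne\emptyset}A(\mathbf a\rceil\mathbf c)B(\mathbf b)$; $ari(A,B)=arit(B)A-arit(A)B+limu(A,B)$. Shuffle: $sh(\mathbf u,\emptyset)=sh(\emptyset,\mathbf u)=\mathbf u$,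 $sh(X\mathbf u,Y\mathbf v)=X\,sh(\mathbf u,Y\mathbf v)+Y\,sh(X\mathbf u,\mathbf v)$. A mould or $v$-mould (same, in variables $v_i$) $M$ is alternal if $M(\emptyset)=0$ and the sum of $M$ over $sh((w_1,\dots,w_s),(w_{s+1},\dots,w_r))$ vanishes for all $1\le s<r$. For a mould $A$, $swap(A)$ is the $v$-mould $swap(A)(v_1,\dots,v_r)=A(v_r,v_{r-1}-v_r,\dots,v_1-v_2)$. $\mathrm{ARI}_{\underline{al}/\underline{al}}$ is the set of alternal moulds $A$ with $swap(A)$ alternal and $A(u_1)$ an even function of $u_1$. *)

(* Defs.v *)
From mathcomp Require Import all_boot all_algebra.

Set Implicit Arguments.
Unset Strict Implicit.
Unset Printing Implicit Defensive.

Import GRing.Theory.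
Local Open Scope ring_scope.

(* A mould is a family of functions A_r : U^r -> K, r >= 0; the family is
   encoded as one function on finite sequences, A_r being its restriction to
   the sequences of size r.  The variables range over an arbitrary additive
   group U, since only sums and differences of variables are ever taken.  The
   same type serves for moulds (variables u_i) and v-moulds (variables v_i). *)
Definition mould (U : zmodType) (K : fieldType) := seq U -> K.

(* The terms of the shuffle of s and t, listed with multiplicity. *)
Fixpoint shuffle (T : Type) (s : seq T) : seq T -> seq (seq T) :=
  fix shuffle_s (t : seq T) : seq (seq T) :=
    match s, t with
    | [::], _ => [:: t]
    | _, [::] => [:: s]
    | x :: s', y :: t' =>
        [seq x :: w | w <- shuffle s' t] ++ [seq y :: w | w <- shuffle_s t']
    end.

(* All (a, b, c) with w = a ++ b ++ c, empty factors included. *)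
Definition factor3 (T : Type) (w : seq T) : seq (seq T * seq T * seq T) :=
  [seq (take k w, take l (drop k w), drop (k + l) w)
     | k <- iota 0 (size w).+1, l <- iota 0 (size w - k).+1].

Section Moulds.

Variables (U : zmodType) (K : fieldType).
Implicit Types (A B M : mould U K) (a b c w v : seq U).

Definition mould0 : mould U K := fun=> 0.

Definition mould_add A B : mould U K := fun w => A w + B w.

Definition mould_sub A B : mould U K := fun w => A w - B w.

Definition mould_scale (x : K) A : mould U K := fun w => x * A w.

Definition mu A B : mould U K := fun w =>
  \sum_(i < (size w).+1) A (take i w) * B (drop i w).

Definition limu A B : mould U K := mould_sub (mu A B) (mu B A).

(* The word written a "left-ceiling" c for w = a ++ b ++ c: the letters of b
   are added to the first letter of c.  The value at c = [::] is not used. *)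
Definition flex_left a b c : seq U :=
  if c is x :: c' then a ++ (\sum_(y <- b) y + x) :: c' else a.

(* The word written a "right-ceiling" c for w = a ++ b ++ c: the letters of b
   are added to the last letter of a.  The value at a = [::] is not used. *)
Definition flex_right a b c : seq U :=
  if a is x :: a' then belast x a' ++ (last x a' + \sum_(y <- b) y) :: c else c.

Definition arit B A : mould U K := fun w =>
    \sum_(t <- factor3 w | let: (a, b, c) := t in (b != [::]) && (c != [::]))
       (let: (a, b, c) := t in A (flex_left a b c) * B b)
  - \sum_(t <- factor3 w | let: (a, b, c) := t in (a != [::]) && (b != [::]))
       (let: (a, b, c) := t in A (flex_right a b c) * B b).

Definition ari A B : mould U K :=
  mould_add (mould_sub (arit B A) (arit A B)) (limu A B).

Definition alternal M : Prop :=
  M [::] = 0 /\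
  forall w (s : nat), (1 <= s < size w)%N ->
    \sum_(x <- shuffle (take s w) (drop s w)) M x = 0.

(* For v = (v_1, ..., v_r), the argument of A below is
   (v_r, v_(r-1) - v_r, ..., v_1 - v_2); its first entry arises as v_r - 0. *)
Definition swap A : mould U K := fun v =>
  A (pairmap (fun x y => y - x) 0 (rev v)).

Definition ARI_al_al A : Prop :=
  [/\ alternal A, alternal (swap A) & forall u : U, A [:: - u] = A [:: u]].

End Moulds.

(* Main.v *)
(* For [B] alternal, the transpose of [arit B] acts on words as a derivation of
   the shuffle product: in a shuffle of two words, the blocks mixing letters of
   both are killed by [B], and the blocks coming from one word but absorbed by
   a letter of the other cancel between the two sums of [arit B].  Hence [ari]
   preserves alternality.
   For the swap, [A (w_1 - w_0, ..., w_r - w_(r-1))] is alternal in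
   [w_1, ..., w_r] and invariant under cyclic rotation of [w_0, ..., w_r] (push
   invariance, a consequence of alternality of both [A] and its swap).  By this
   invariance, [ari A B] has for fixed [w_0] the same shape as before, with the
   absorbing letter unchanged and the block measured relative to that letter,
   so the same argument applies. *)

Require Import Defs.
From mathcomp Require Import all_boot all_algebra ring.
Import GRing.Theory.
Local Open Scope ring_scope.
Set Implicit Arguments.
Unset Strict Implicit.
Unset Printing Implicit Defensive.

(** * Sums over shuffles and over factorizations of words *)

Section Sums.

Variables (T : Type) (V : zmodType).
Implicit Types (M : seq T -> V) (s t w : seq T) (Phi : seq T -> seq T -> V).

Definition shuffle_sum M s t := \sum_(w <- shuffle s t) M w.

Definition cut_sum Phi w :=
  \sum_(i < (size w).+1) Phi (take i w) (drop i w).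

(** With the default 0, [cut_sum (fun a => uncons (fun x c => _))] is the sum over all
    factorizations into [a], a marked letter [x] and [c]. *)
Definition uncons (f : T -> seq T -> V) w := if w is x :: w' then f x w' else 0.

Lemma eq_shuffle_sum M N : M =1 N -> shuffle_sum M =2 shuffle_sum N.
Proof. by move=> eqMN s t; apply: eq_bigr. Qed.

Lemma eq_cut_sum Phi Psi : Phi =2 Psi -> cut_sum Phi =1 cut_sum Psi.
Proof. by move=> eqP w; apply: eq_bigr => i _; apply: eqP. Qed.

Lemma eq_uncons f g : f =2 g -> uncons f =1 uncons g.
Proof. by move=> eqfg [|x w] //=; apply: eqfg. Qed.

Lemma shuffle0s t : shuffle [::] t = [:: t].
Proof. by case: t. Qed.

Lemma shuffles0 s : shuffle s [::] = [:: s].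
Proof. by case: s. Qed.

Lemma shuffle_sum0s M t : shuffle_sum M [::] t = M t.
Proof. by rewrite /shuffle_sum shuffle0s big_seq1. Qed.

Lemma shuffle_sums0 M s : shuffle_sum M s [::] = M s.
Proof. by rewrite /shuffle_sum shuffles0 big_seq1. Qed.

Lemma shuffle_sum_cons M x s y t :
  shuffle_sum M (x :: s) (y :: t) =
  shuffle_sum (fun w => M (x :: w)) s (y :: t) +
  shuffle_sum (fun w => M (y :: w)) (x :: s) t.
Proof. by rewrite /shuffle_sum /= big_cat !big_map. Qed.

Lemma shuffle_sumD M N s t :
  shuffle_sum (fun w => M w + N w) s t = shuffle_sum M s t + shuffle_sum N s t.
Proof. exact: big_split. Qed.

Lemma shuffle_sumB M N s t :
  shuffle_sum (fun w => M w - N w) s t = shuffle_sum M s t - shuffle_sum N s t.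
Proof. exact: sumrB. Qed.

Lemma shuffle_sum_0 s t : shuffle_sum (fun=> 0) s t = 0.
Proof. exact: big1. Qed.

Lemma shuffle_sumC M s t : shuffle_sum M s t = shuffle_sum M t s.
Proof.
elim: s t M => [|x s IHs] t M; first by rewrite shuffle_sum0s shuffle_sums0.
elim: t M => [|y t IHt] M; first by rewrite shuffle_sum0s shuffle_sums0.
by rewrite !shuffle_sum_cons IHs IHt addrC.
Qed.

Lemma exchange_shuffle_sum (M : seq T -> seq T -> V) s t s' t' :
  shuffle_sum (fun w => shuffle_sum (M w) s' t') s t =
  shuffle_sum (fun w' => shuffle_sum (M^~ w') s t) s' t'.
Proof. exact: exchange_big. Qed.

Lemma shuffle_sum_cut_sum (M : seq T -> seq T -> seq T -> V) s t w :
  shuffle_sum (fun v => cut_sum (M v) w) s t =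
  cut_sum (fun a b => shuffle_sum (fun v => M v a b) s t) w.
Proof. exact: exchange_big. Qed.

Lemma shuffle_sum_uncons (f : seq T -> T -> seq T -> V) s t w :
  shuffle_sum (fun v => uncons (f v) w) s t =
  uncons (fun x c => shuffle_sum (fun v => f v x c) s t) w.
Proof. by case: w => //=; apply: shuffle_sum_0. Qed.

Lemma cut_sum_uncons (f : seq T -> seq T -> T -> seq T -> V) w v :
  cut_sum (fun a b => uncons (f a b) v) w =
  uncons (fun x c => cut_sum (fun a b => f a b x c) w) v.
Proof. by case: v => //=; apply: big1. Qed.

Lemma exchange_cut_sum (Phi : seq T -> seq T -> seq T -> seq T -> V) w v :
  cut_sum (fun a b => cut_sum (Phi a b) v) w =
  cut_sum (fun c d => cut_sum (fun a b => Phi a b c d) w) v.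
Proof. exact: exchange_big. Qed.

Lemma cut_sumD Phi Psi w :
  cut_sum (fun a b => Phi a b + Psi a b) w = cut_sum Phi w + cut_sum Psi w.
Proof. exact: big_split. Qed.

Lemma cut_sumB Phi Psi w :
  cut_sum (fun a b => Phi a b - Psi a b) w = cut_sum Phi w - cut_sum Psi w.
Proof. exact: sumrB. Qed.

Lemma cut_sum_0 w : cut_sum (fun _ _ => 0) w = 0.
Proof. exact: big1. Qed.

Lemma unconsD f g w :
  uncons (fun x c => f x c + g x c) w = uncons f w + uncons g w.
Proof. by case: w => //=; rewrite addr0. Qed.

Lemma uncons_0 w : uncons (fun _ _ => 0) w = 0.
Proof. by case: w. Qed.

Lemma cut_sum_nil Phi : cut_sum Phi [::] = Phi [::] [::].
Proof. by rewrite /cut_sum big_ord_recl big_ord0 addr0. Qed.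

Lemma cut_sum_cons Phi x w :
  cut_sum Phi (x :: w) = Phi [::] (x :: w) + cut_sum (fun a b => Phi (x :: a) b) w.
Proof. by rewrite /cut_sum big_ord_recl. Qed.

Lemma cut_sum_last Phi w :
  cut_sum Phi w = cut_sum (fun a b => uncons (fun x c => Phi a (x :: c)) b) w
                  + Phi w [::].
Proof.
elim: w Phi => [|x w IHw] Phi; first by rewrite !cut_sum_nil add0r.
by rewrite !cut_sum_cons IHw addrA.
Qed.

Lemma cut_sum_rcons Phi x w :
  cut_sum Phi (rcons w x) =
  cut_sum (fun a b => Phi a (rcons b x)) w + Phi (rcons w x) [::].
Proof.
elim: w Phi => [|y w IHw] Phi; first by rewrite cut_sum_cons !cut_sum_nil.
by rewrite rcons_cons !cut_sum_cons IHw addrA.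
Qed.

(** Both sides range over the cuts with nonempty first factor; its first letter is marked on the
    left, its last letter on the right. *)
Lemma uncons_cut_sum Phi w :
  uncons (fun x => cut_sum (fun a b => Phi (x :: a) b)) w =
  cut_sum (fun a => uncons (fun x c => Phi (rcons a x) c)) w.
Proof.
elim: w Phi => [|x w IHw] Phi; first by rewrite cut_sum_nil.
rewrite cut_sum_cons /= -(IHw (fun a => Phi (x :: a))).
by case: w {IHw} => [|y w]; rewrite ?cut_sum_nil ?cut_sum_cons ?addr0.
Qed.

Lemma cut_sum_first Phi w :
  cut_sum Phi w =
  Phi [::] w + cut_sum (fun a => uncons (fun x => Phi (rcons a x))) w.
Proof.
rewrite -uncons_cut_sum.
by case: w => [|x w]; rewrite ?cut_sum_nil ?cut_sum_cons ?addr0.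
Qed.

(* The deconcatenation coproduct is multiplicative for the shuffle product. *)
Lemma shuffle_sum_cut Phi s t :
  shuffle_sum (cut_sum Phi) s t =
  cut_sum (fun s1 s2 => cut_sum (fun t1 t2 =>
    shuffle_sum (fun w => shuffle_sum (Phi w) s2 t2) s1 t1) t) s.
Proof.
elim: s t Phi => [|x s IHs] t Phi.
  rewrite shuffle_sum0s cut_sum_nil; apply: eq_cut_sum => t1 t2.
  by rewrite !shuffle_sum0s.
elim: t Phi => [|y t IHt] Phi.
  rewrite shuffle_sums0; apply: eq_cut_sum => s1 s2.
  by rewrite cut_sum_nil !shuffle_sums0.
have consE z u v : shuffle_sum (fun w => cut_sum Phi (z :: w)) u v =
    shuffle_sum (fun w => Phi [::] (z :: w)) u v +
    shuffle_sum (cut_sum (fun a => Phi (z :: a))) u v.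
  by rewrite -shuffle_sumD; apply: eq_shuffle_sum => w; rewrite cut_sum_cons.
rewrite shuffle_sum_cons !consE addrACA -shuffle_sum_cons IHs IHt.
rewrite !cut_sum_cons shuffle_sum0s -!addrA; congr (_ + _).
rewrite addrCA; congr (_ + _).
  by apply: eq_cut_sum => t1 t2; rewrite !shuffle_sum0s.
rewrite -cut_sumD; apply: eq_cut_sum => s1 s2.
rewrite !cut_sum_cons !shuffle_sums0 -addrA -cut_sumD; congr (_ + _).
by apply: eq_cut_sum => t1 t2; rewrite shuffle_sum_cons.
Qed.

(** Each shuffle splits at the letter [y]; [t1] collects the letters of [t] placed before it. *)
Lemma shuffle_sum_insert M a y c t :
  shuffle_sum M (a ++ y :: c) t =
  cut_sum (fun t1 t2 => shuffle_sum (fun a' =>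
    shuffle_sum (fun c' => M (a' ++ y :: c')) c t2) a t1) t.
Proof.
elim: a t M => [|x a IHa] t M.
  elim: t M => [|z t IHt] M.
    by rewrite cut_sum_nil shuffle_sum0s !shuffle_sums0.
  rewrite shuffle_sum_cons cut_sum_cons shuffle_sum0s IHt; congr (_ + _).
  by apply: eq_cut_sum => t1 t2; rewrite !shuffle_sum0s.
elim: t M => [|z t IHt] M; first by rewrite cut_sum_nil !shuffle_sums0.
rewrite shuffle_sum_cons cut_sum_cons shuffle_sums0 IHa IHt.
rewrite cut_sum_cons shuffle_sums0 -addrA; congr (_ + _).
by rewrite -cut_sumD; apply: eq_cut_sum => t1 t2; rewrite shuffle_sum_cons.
Qed.

Lemma shuffle_sum_of_uncons f s t :
  shuffle_sum (uncons f) s t =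
  uncons (fun x s' => shuffle_sum (f x) s' t) s +
  uncons (fun y t' => shuffle_sum (f y) s t') t.
Proof.
case: s t => [|x s] [|y t].
- by rewrite shuffle_sum0s addr0.
- by rewrite shuffle_sum0s /= add0r shuffle_sum0s.
- by rewrite shuffle_sums0 /= addr0 shuffle_sums0.
- by rewrite shuffle_sum_cons.
Qed.

(** Alternality in a form suited to induction: the two words are nonempty by construction instead of
    being cut out of one word. *)
Definition kills_shuffles M :=
  M [::] = 0 /\ forall x s y t, shuffle_sum M (x :: s) (y :: t) = 0.

(** By [shuffle_sum_cut], a prefix of a shuffle is a shuffle of two prefixes; it contributes only if
    exactly one of them is nonempty. *)
Lemma shuffle_sum_cut_kills Phi s t :
  (forall w, kills_shuffles (Phi^~ w)) ->
  shuffle_sum (cut_sum Phi) s t =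
  cut_sum (fun s1 s2 => shuffle_sum (Phi s1) s2 t) s +
  cut_sum (fun t1 t2 => shuffle_sum (Phi t1) s t2) t.
Proof.
move=> killPhi; have Phi0 w : Phi [::] w = 0 by case: (killPhi w).
have Phi0S u v : shuffle_sum (Phi [::]) u v = 0 by apply: big1.
rewrite shuffle_sum_cut; case: s => [|x s].
  rewrite !cut_sum_nil shuffle_sum0s Phi0 add0r; apply: eq_cut_sum => t1 t2.
  by rewrite shuffle_sum0s.
rewrite !cut_sum_cons Phi0S add0r addrC; congr (_ + _).
  apply: eq_cut_sum => s1 s2; case: t => [|y t].
    by rewrite cut_sum_nil !shuffle_sums0.
  rewrite cut_sum_cons shuffle_sums0 -[RHS]addr0; congr (_ + _).
  apply: big1 => i _; rewrite exchange_shuffle_sum; apply: big1 => w _.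
  by case: (killPhi w) => _; apply.
by apply: eq_cut_sum => t1 t2; rewrite shuffle_sum0s.
Qed.

(** The block [b] stands before the letter [x] in the first sum and after it in the second, as for
    the absorbing letter in the two sums of [arit]. *)
Definition slide (h : seq T -> T -> seq T -> V) w :=
  cut_sum (fun b => uncons (h b)) w - uncons (fun x => cut_sum (h^~ x)) w.

Lemma eq_slide h k : (forall b x c, h b x c = k b x c) -> slide h =1 slide k.
Proof.
move=> eqhk w; congr (_ - _).
  by apply: eq_cut_sum => a b; apply: eq_uncons => x c.
by apply: eq_uncons => x c; apply: eq_cut_sum => a b.
Qed.

Lemma slide_0 w : slide (fun _ _ _ => 0) w = 0.
Proof.
rewrite /slide (eq_uncons (fun x => cut_sum_0)) uncons_0 subr0.
by apply: big1 => i _; apply: uncons_0.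
Qed.

Lemma shuffle_sum_exchange_slide (h : seq T -> seq T -> T -> seq T -> V) s t w :
  shuffle_sum (fun v => slide (h v) w) s t =
  slide (fun b x c => shuffle_sum (fun v => h v b x c) s t) w.
Proof.
rewrite shuffle_sumB shuffle_sum_cut_sum shuffle_sum_uncons; congr (_ - _).
  by apply: eq_cut_sum => a b; rewrite shuffle_sum_uncons.
by apply: eq_uncons => x c; rewrite shuffle_sum_cut_sum.
Qed.

Lemma cut_sum_exchange_slide (h : seq T -> seq T -> seq T -> T -> seq T -> V) w v :
  cut_sum (fun a1 a2 => slide (h a1 a2) v) w =
  slide (fun b x c => cut_sum (fun a1 a2 => h a1 a2 b x c) w) v.
Proof.
rewrite cut_sumB exchange_cut_sum cut_sum_uncons; congr (_ - _).
  by apply: eq_cut_sum => a b; rewrite cut_sum_uncons.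
by apply: eq_uncons => x c; rewrite exchange_cut_sum.
Qed.

(* The terms in which the slid block and the letter it passes come from
   different factors of the shuffle cancel in the difference defining slide. *)
Lemma shuffle_sum_slide h s t :
  (forall x c, kills_shuffles (fun b => h b x c)) ->
  shuffle_sum (slide h) s t =
  slide (fun b x c => shuffle_sum (h b x) c t) s +
  slide (fun b x c => shuffle_sum (h b x) s c) t.
Proof.
move=> killh; rewrite shuffle_sumB shuffle_sum_cut_kills; last first.
  case=> [|x c] //=; split=> // *; exact: shuffle_sum_0.
rewrite (eq_cut_sum (fun s1 s2 => shuffle_sum_of_uncons (h s1) s2 t)).
rewrite (eq_cut_sum (fun t1 t2 => shuffle_sum_of_uncons (h t1) s t2)).
rewrite shuffle_sum_of_uncons.
rewrite (eq_uncons (fun x s' => shuffle_sum_cut_kills s' t (killh x))).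
rewrite (eq_uncons (fun x t' => shuffle_sum_cut_kills s t' (killh x))).
rewrite !cut_sumD !unconsD !cut_sum_uncons /slide.
(* The mixed terms are [b], with block from [s] and letter from [t], and [c], with the roles
   exchanged; each occurs with both signs. *)
set a := cut_sum _ s; set b := uncons _ t; set c := uncons _ s.
set d := cut_sum _ t; set e := uncons _ s; set f := uncons _ t.
rewrite [c + d]addrC addrACA [b + f]addrC [e + c + _]addrACA [c + b]addrC.
by rewrite opprD [LHS]addrACA subrr addr0 opprD addrACA.
Qed.

(* Since [sh (a y c, t)] is the sum of [sh (a, t1) y sh (c, t2)] over the
   factorizations [t = t1 t2], each half of [shuffle_sum_slide] sums to a
   value of [N b x] on a shuffle. *)
Lemma kills_cut_slide (N : seq T -> T -> seq T -> V) (f : seq T -> T -> T) :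
  (forall b x, kills_shuffles (N b x)) ->
  (forall a x c, kills_shuffles (fun b => N b x (a ++ f b x :: c))) ->
  kills_shuffles
    (cut_sum (fun a => slide (fun b x c => N b x (a ++ f b x :: c)))).
Proof.
move=> killN killb.
have killS b x a y c z t : shuffle_sum (N b x) (a ++ y :: c) (z :: t) = 0.
  by case: (killN b x) => _ kill; case: a => [|a0 a]; apply: kill.
split=> [|x s y t]; first by rewrite cut_sum_nil /slide cut_sum_nil /= subr0.
rewrite shuffle_sum_cut.
under eq_cut_sum => s1 s2.
  under eq_cut_sum => t1 t2.
    rewrite (eq_shuffle_sum (fun w => shuffle_sum_slide s2 t2 (killb w))).
    rewrite shuffle_sumD !shuffle_sum_exchange_slide; over.
  rewrite cut_sumD cut_sum_exchange_slide; over.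
rewrite cut_sumD exchange_cut_sum -[RHS]addr0; congr (_ + _).
  apply: big1 => i _; rewrite -[RHS](slide_0 (drop i (x :: s))).
  by apply: eq_slide => b z c; rewrite -shuffle_sum_insert.
apply: big1 => i _; rewrite cut_sum_exchange_slide.
rewrite -[RHS](slide_0 (drop i (y :: t))); apply: eq_slide => b z c.
rewrite -[RHS](killS b z (take i (y :: t)) (f b z) c x s) shuffle_sum_insert.
apply: eq_cut_sum => s1 s2; rewrite shuffle_sumC; apply: eq_shuffle_sum => w.
exact: shuffle_sumC.
Qed.

Lemma eq_kills_shuffles M N : M =1 N -> kills_shuffles M -> kills_shuffles N.
Proof.
move=> eqMN [M0 killM]; split=> [|x s y t]; first by rewrite -eqMN.
by rewrite -(eq_shuffle_sum eqMN).
Qed.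

Lemma kills_shufflesD M N :
  kills_shuffles M -> kills_shuffles N -> kills_shuffles (fun w => M w + N w).
Proof.
move=> [M0 killM] [N0 killN]; split=> [|x s y t]; first by rewrite M0 N0 addr0.
by rewrite shuffle_sumD killM killN addr0.
Qed.

Lemma kills_shufflesB M N :
  kills_shuffles M -> kills_shuffles N -> kills_shuffles (fun w => M w - N w).
Proof.
move=> [M0 killM] [N0 killN]; split=> [|x s y t]; first by rewrite M0 N0 subr0.
by rewrite shuffle_sumB killM killN subr0.
Qed.

Lemma big_factor3 (P : pred (seq T * seq T * seq T)) F w :
  \sum_(p <- factor3 w | P p) F p =
  cut_sum (fun a => cut_sum (fun b c => if P (a, b, c) then F (a, b, c) else 0)) w
  :> V.
Proof.
have iotaE n : iota 0 n.+1 = index_iota 0 n.+1 by [].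
rewrite big_mkcond /factor3 big_allpairs_dep iotaE big_mkord.
apply: eq_bigr => k _; rewrite iotaE big_mkord -size_drop.
by apply: eq_bigr => l _; rewrite drop_drop addnC.
Qed.

End Sums.

Lemma shuffle_sum_map (T T' : Type) (V : zmodType) (f : T -> T')
    (M : seq T' -> V) s t :
  shuffle_sum M (map f s) (map f t) = shuffle_sum (fun w => M (map f w)) s t.
Proof.
elim: s t M => [|x s IHs] t M; first by rewrite !shuffle_sum0s.
elim: t M => [|y t IHt] M; first by rewrite !shuffle_sums0.
by rewrite !map_cons !shuffle_sum_cons -!map_cons IHs IHt.
Qed.

Lemma kills_shuffles_map (T T' : Type) (V : zmodType) (f : T -> T')
    (M : seq T' -> V) :
  kills_shuffles M -> kills_shuffles (fun w => M (map f w)).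
Proof. by case=> M0 killM; split=> // *; rewrite -shuffle_sum_map; apply: killM. Qed.

Lemma cut_sum_pairmap (T T' : Type) (V : zmodType) (f : T -> T -> T')
    (Phi : seq T' -> seq T' -> V) z s :
  cut_sum Phi (pairmap f z s) =
  cut_sum (fun a b => Phi (pairmap f z a) (pairmap f (last z a) b)) s.
Proof.
elim: s z Phi => [|x s IHs] z Phi; first by rewrite !cut_sum_nil.
by rewrite /= !cut_sum_cons IHs.
Qed.

Lemma uncons_pairmap (T T' : Type) (V : zmodType) (f : T -> T -> T')
    (g : T' -> seq T' -> V) z s :
  uncons g (pairmap f z s) = uncons (fun y c => g (f z y) (pairmap f y c)) s.
Proof. by case: s. Qed.

Lemma perm_shuffle (T : eqType) (s t w : seq T) :
  w \in shuffle s t -> perm_eq w (s ++ t).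
Proof.
elim: s t w => [|x s IHs] t w.
  by rewrite shuffle0s inE => /eqP ->.
elim: t w => [|y t IHt] w; first by rewrite shuffles0 inE cats0 => /eqP ->.
rewrite /= mem_cat => /orP[] /mapP[v v_in ->].
  by rewrite /= perm_cons IHs.
have -> : x :: s ++ y :: t = (x :: s) ++ y :: t by [].
by rewrite perm_sym perm_catC /= perm_cons perm_catC perm_sym IHt.
Qed.

(** * Alternal moulds: stability under the bracket and under reversal *)

Section Moulds.

Variables (U : zmodType) (K : fieldType).
Implicit Types (A B M : mould U K) (a b c p q s t w : seq U).

Lemma alternalP M : alternal M <-> kills_shuffles M.
Proof.
split=> -[M0 killM]; split=> //.
  move=> x s y t; have := killM ((x :: s) ++ y :: t) (size (x :: s)).
  rewrite take_size_cat // drop_size_cat //; apply.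
  by rewrite size_cat /= addnS !ltnS leq_addr.
move=> w n /andP[n_gt0 n_lt]; rewrite -/(shuffle_sum M _ _).
case Et: (take n w) => [|x s].
  by have := size_takel (ltnW n_lt); rewrite Et => /= n0; rewrite -n0 in n_gt0.
case Ed: (drop n w) => [|y t] //.
by have := size_drop n w; rewrite Ed => /esym/eqP; rewrite subn_eq0 leqNgt n_lt.
Qed.

Lemma shuffle_sumZr M (k : K) s t :
  shuffle_sum (fun w => M w * k) s t = shuffle_sum M s t * k.
Proof. by rewrite /shuffle_sum mulr_suml. Qed.

Lemma shuffle_sumZl M (k : K) s t :
  shuffle_sum (fun w => k * M w) s t = k * shuffle_sum M s t.
Proof. by rewrite /shuffle_sum mulr_sumr. Qed.

Lemma kills_shufflesZr M (k : K) :
  kills_shuffles M -> kills_shuffles (fun w => M w * k).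
Proof.
by case=> M0 killM; split=> [|*]; rewrite ?M0 ?shuffle_sumZr ?killM mul0r.
Qed.

Lemma kills_shufflesZl M (k : K) :
  kills_shuffles M -> kills_shuffles (fun w => k * M w).
Proof.
by case=> M0 killM; split=> [|*]; rewrite ?M0 ?shuffle_sumZl ?killM mulr0.
Qed.

(** Alternality of [A] forces the prefix to come from one word; that of [B] then forces the suffix
    to be exactly the other word. *)
Lemma shuffle_sum_mu A B x s y t :
  kills_shuffles A -> kills_shuffles B ->
  shuffle_sum (mu A B) (x :: s) (y :: t) =
  A (x :: s) * B (y :: t) + A (y :: t) * B (x :: s).
Proof.
move=> killA [B0 killB].
rewrite (@shuffle_sum_cut_kills _ _ (fun a b => A a * B b)); last first.
  by move=> w; apply: kills_shufflesZr.
congr (_ + _); rewrite cut_sum_last.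
  rewrite shuffle_sumZl shuffle_sum0s -[RHS]add0r; congr (_ + _).
  apply: big1 => i _; case: (drop _ _) => //= z v.
  by rewrite shuffle_sumZl killB mulr0.
rewrite shuffle_sumZl shuffle_sums0 -[RHS]add0r; congr (_ + _).
apply: big1 => i _; case: (drop _ _) => //= z v.
by rewrite shuffle_sumZl killB mulr0.
Qed.

(** The two products left by [shuffle_sum_mu] are exchanged when [A] and [B] are, as [K] is
    commutative. *)
Lemma kills_limu A B :
  kills_shuffles A -> kills_shuffles B -> kills_shuffles (limu A B).
Proof.
move=> killA killB; have [A0 _] := killA; have [B0 _] := killB.
split=> [|x s y t].
  by rewrite /limu /mould_sub /mu !big_ord_recl !big_ord0 /= A0 B0 subrr.
rewrite shuffle_sumB !shuffle_sum_mu // [X in _ - X]addrC.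
by rewrite mulrC [X in _ + X - _]mulrC subrr.
Qed.

Lemma flex_right_rcons a x b c :
  flex_right (rcons a x) b c = a ++ (x + \sum_(y <- b) y) :: c.
Proof. by case: a => [|y a] //=; rewrite belast_rcons last_rcons. Qed.

Lemma aritE A B : B [::] = 0 ->
  arit B A =1 cut_sum (fun a =>
    slide (fun b x c => A (a ++ (\sum_(y <- b) y + x) :: c) * B b)).
Proof.
move=> B0 w; rewrite /arit !big_factor3 /slide cut_sumB; congr (_ - _).
  apply: eq_cut_sum => a v; apply: eq_cut_sum => b [|x c] /=.
    by rewrite andbF.
  by case: b => [|y b] //=; rewrite B0 mulr0.
(* In the second sum the absorbing letter is the last one of the first factor, so it is split off
   there. *)
rewrite cut_sum_first [X in X + _]big1 ?add0r //.
apply: eq_cut_sum => a v; apply: eq_uncons => x u; apply: eq_cut_sum => b c.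
rewrite flex_right_rcons [x + _]addrC.
case: b => [|y b]; first by rewrite andbF B0 mulr0.
by case: (a).
Qed.

Lemma kills_arit A B :
  kills_shuffles A -> kills_shuffles B -> kills_shuffles (arit B A).
Proof.
move=> killA killB; have [B0 killB'] := killB.
apply: eq_kills_shuffles (fsym (aritE A B0)) _.
apply: (@kills_cut_slide _ _ (fun b x w => A w * B b)
         (fun b x => \sum_(y <- b) y + x)) => [b x|a x c].
  exact: kills_shufflesZr.
split=> [|y s z t]; first by rewrite B0 mulr0.
set g := fun w => A _ * _.
(* All shuffles of two words have the same letter sum, so the factor [A] is constant and alternality
   of [B] applies. *)
rewrite -[RHS](mulr0 (A (a ++ (\sum_(y <- (y :: s) ++ z :: t) y + x) :: c))).
rewrite -(killB' y s z t) -shuffle_sumZl; apply: eq_big_seq => w.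
by move/perm_shuffle=> perm_w; rewrite /g (perm_big _ perm_w).
Qed.

Lemma kills_ari A B :
  kills_shuffles A -> kills_shuffles B -> kills_shuffles (ari A B).
Proof.
move=> killA killB; apply: kills_shufflesD; last exact: kills_limu.
by apply: kills_shufflesB; apply: kills_arit.
Qed.

(** The shuffle relation of [x :: a] with [y :: b] trades the leading letter [x] for [y] at the cost
    of a sign; this is repeated until [b] is exhausted. *)
Lemma kills_catrev M a x b : kills_shuffles M ->
  shuffle_sum (fun w => M (x :: w)) a b =
  (-1) ^+ size b * M (catrev b (x :: a)).
Proof.
case=> _ killM; elim: b x a => [|y b IHb] x a.
  by rewrite shuffle_sums0 mul1r.
have /eqP := killM x a y b; rewrite shuffle_sum_cons addr_eq0 => /eqP ->.
by rewrite IHb /= exprS mulN1r mulNr.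
Qed.

Lemma kills_rev M w : kills_shuffles M ->
  M w = (-1) ^+ (size w).-1 * M (rev w).
Proof.
case: w => [|x w] killM; first by rewrite mul1r.
by have := kills_catrev [::] x w killM; rewrite shuffle_sum0s.
Qed.

(** The sign in [kills_rev] depends only on the length, which is constant over a shuffle. *)
Lemma kills_shuffles_rev M :
  kills_shuffles M -> kills_shuffles (fun w => M (rev w)).
Proof.
move=> killM; have [M0 killM'] := killM; split=> // x s y t.
set n := size ((x :: s) ++ y :: t).
rewrite -[RHS](mulr0 ((-1) ^+ n.-1)) -(killM' x s y t) -shuffle_sumZl.
apply: eq_big_seq => w /perm_shuffle/perm_size size_w.
by rewrite (kills_rev (rev w) killM) revK size_rev size_w.
Qed.

(** * Moulds as functions of paths, and push invariance *)

Definition differences p : seq U :=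
  if p is z :: s then pairmap (fun x y => y - x) z s else [::].

(* With [u_i = w_i - w_(i-1)], a mould becomes a function of [w_0, ..., w_r];
   swapping amounts to setting [w_0 = 0] and [v_i = w_(r+1-i)], and the push
   operator becomes the cyclic rotation of [w_0, ..., w_r]. *)
Definition path_mould A p := A (differences p).

Lemma differences_rcons p x y :
  differences (rcons (rcons p x) y) = rcons (differences (rcons p x)) (y - x).
Proof.
case: p => [|z p] //=; elim: p z => [|z' p IHp] z //=.
by rewrite IHp.
Qed.

Lemma rev_differences p :
  rev (differences p) = differences (map -%R (rev p)).
Proof.
elim: p => [|z [|y p] IHp] //.
rewrite [differences _]/= rev_cons -/(differences (y :: p)) IHp.
by rewrite !rev_cons !map_rcons differences_rcons opprK addrC.
Qed.

Lemma size_differences p : size (differences p) = (size p).-1.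
Proof. by case: p => //= z s; rewrite size_pairmap. Qed.

(** Differences are invariant under translation, so [z] can be moved to 0, where the function is
    [swap A] on reversed words. *)
Lemma kills_path_mould A z :
  kills_shuffles (swap A) -> kills_shuffles (fun s => path_mould A (z :: s)).
Proof.
move/kills_shuffles_rev/(kills_shuffles_map (fun x => x - z)).
apply: eq_kills_shuffles => s.
rewrite /swap revK /path_mould /=; congr (A _).
have: 0 = z - z by rewrite subrr.
(* The induction runs over two starting points related by [e = x - z]. *)
move: (0) {1 4}z => e x; elim: s e x => [|y s IHs] e x //= ->.
by rewrite opprB addrA subrK (IHs _ y).
Qed.

(** Two reversals with the same sign: alternality of [A] reverses the differences, hence reverses
    and negates the path; alternality of [swap A] reverses the points after the first. *)
Lemma path_mould_negpush A q x :
  kills_shuffles A -> kills_shuffles (swap A) ->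
  path_mould A (rcons q x) = path_mould A (map -%R (x :: q)).
Proof.
move=> killA killsA; rewrite /path_mould (kills_rev _ killA) rev_differences.
rewrite size_differences size_rcons rev_rcons /=.
have := kills_rev (map -%R q) (kills_path_mould (- x) killsA).
by rewrite size_map map_rev => /esym.
Qed.

Lemma negpush_iter p q (F : seq U -> K) :
  (forall q x, F (rcons q x) = F (map -%R (x :: q))) ->
  F (p ++ q) = F (iter (size p) (map -%R) (q ++ p)).
Proof.
elim: p q F => [|x p IHp] q F pushF; first by rewrite cats0.
have pushF' y s : F (y :: s) = F (map -%R (rcons s y)).
  by rewrite map_rcons pushF map_cons opprK (mapK (@opprK U)).
rewrite cat_cons pushF' rcons_cat.
rewrite (IHp (rcons q x) (fun w => F (map -%R w))) ?cat_rcons //.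
by move=> q' y; rewrite map_rcons pushF map_cons.
Qed.

Lemma iter_map_opp n p :
  iter n (map -%R) p = if odd n then map -%R p else p.
Proof.
elim: n => //= n ->; case: (odd n) => //=.
by rewrite (mapK (@opprK U)).
Qed.

(* For [p] of odd size, iterate the neg-push invariance [size p] times.  For
   [p = x t z] of even size, that invariance turns the shuffle relation of [x]
   with [t] after [z] into an alternating sum over rotations of [t z]; it
   differs from the opposite of the one for the rotated word by the claim. *)
Lemma path_mould_even A p : ARI_al_al A ->
  path_mould A (map -%R p) = path_mould A p.
Proof.
case=> /alternalP killA /alternalP killsA even1.
set F := path_mould A.
have pushF q x : F (rcons q x) = F (map -%R (x :: q)).
  exact: path_mould_negpush.
have pushNF q x : F (map -%R (rcons q x)) = F (map -%R (map -%R (x :: q))).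
  by rewrite map_rcons pushF map_cons.
have killNF z : kills_shuffles (fun s => F (map -%R (z :: s))).
  exact: kills_shuffles_map (kills_path_mould (- z) killsA).
(* Shuffling [x] into [t] inserts it at each cut; each term is then rotated until [x] comes
   first. *)
have insert_rot (G : seq U -> K) z x t :
    (forall q x, G (rcons q x) = G (map -%R (x :: q))) ->
    kills_shuffles (fun s => G (z :: s)) -> t != [::] ->
    cut_sum (fun t1 t2 =>
      G (iter (size t1).+1 (map -%R) (x :: t2 ++ z :: t1))) t = 0.
  case: t => // y t pushG [_ /(_ x [::] y t)].
  rewrite (@shuffle_sum_insert _ _ _ [::]) => + _; move=> <-.
  apply: eq_cut_sum => t1 t2; rewrite !shuffle_sum0s.
  by rewrite -[in RHS]cat_cons (negpush_iter (z :: t1) (x :: t2) pushG).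
have [odd_p|] := boolP (odd (size p)).
  by rewrite -[in RHS](cats0 p) negpush_iter //= iter_map_opp odd_p.
case: p => [|x [|y p]] //=.
case/lastP: p => [|t z] even_p.
  (* A path of two points has a single difference: this is evenness in depth one. *)
  by rewrite /F /path_mould /= -opprD even1.
have := insert_rot F z x (y :: t) pushF (kills_path_mould z killsA) isT.
have nil_rcons : rcons t z != [::] by case: (t).
have := insert_rot (fun w => F (map -%R w)) y x (rcons t z) pushNF (killNF y) nil_rcons.
(* The relations share the sum over the cuts of [t]. The remaining extreme terms are [F] at the
   negated path, and [F] at the path negated as many times as it has points. *)
rewrite cut_sum_rcons cut_sum_cons /= => rel2 /eqP.
rewrite addr_eq0 cats1 => /eqP ->.
under eq_cut_sum do rewrite -cat_rcons.
move/eqP: rel2; rewrite addr_eq0 => /eqP ->; rewrite opprK.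
rewrite -!iterS iter_map_opp size_rcons.
by move: even_p; rewrite size_rcons /=; case: (odd _).
Qed.

Lemma path_mould_push A q x :
  ARI_al_al A -> path_mould A (rcons q x) = path_mould A (x :: q).
Proof.
move=> alA; have [/alternalP killA /alternalP killsA _] := alA.
by rewrite path_mould_negpush // path_mould_even.
Qed.

(** * The bracket in path coordinates and alternality of its swap *)

Lemma sum_differences z s :
  \sum_(y <- differences (z :: s)) y = last z s - z.
Proof.
elim: s z => [|x s IHs] z; first by rewrite big_nil subrr.
by rewrite big_cons [X in _ + X]IHs addrC addrA subrK.
Qed.

Lemma mu_differences A B z s : A [::] = 0 ->
  mu A B (differences (z :: s)) =
  cut_sum (fun a => uncons (fun x b =>
    path_mould A (z :: rcons a x) * path_mould B (x :: b))) s.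
Proof.
move=> A0; rewrite -[LHS]/(cut_sum (fun a b => A a * B b) (pairmap _ z s)).
rewrite cut_sum_pairmap cut_sum_first A0 mul0r add0r.
by apply: eq_cut_sum => a b; apply: eq_uncons => x c; rewrite last_rcons.
Qed.

Definition path_slide A B z s :=
  cut_sum (fun a => slide (fun b x c =>
    path_mould A (z :: a ++ x :: c) * path_mould B (x :: b))) s.

(** Both paths start at [z], whereas in [mu_differences] the second starts where the first ends. *)
Definition path_mu A B z s :=
  cut_sum (fun a b => path_mould A (z :: a) * path_mould B (z :: b)) s.

(** Absorbing a block deletes points from the path of [A]. The first sum of [arit] yields the second
    half of [path_slide] up to boundary terms; push invariance of [B] turns the second sum into the
    first half. *)
Lemma arit_differences A B z s :
  A [::] = 0 -> B [::] = 0 ->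
  (forall q x, path_mould B (rcons q x) = path_mould B (x :: q)) ->
  arit B A (differences (z :: s)) =
  path_mu B A z s - mu A B (differences (z :: s)) - path_slide A B z s.
Proof.
move=> A0 B0 pushB; rewrite aritE // mu_differences // /path_slide /slide.
rewrite !cut_sumB opprB addrA; congr (_ - _).
  rewrite [differences _]/= cut_sum_pairmap.
  under eq_cut_sum => s1 s2.
    rewrite cut_sum_pairmap.
    under eq_cut_sum => b c.
      rewrite uncons_pairmap.
      rewrite (eq_uncons (g := fun y c => path_mould A (z :: s1 ++ y :: c) *
                              path_mould B (last z s1 :: b))); last first.
        move=> y u; rewrite [X in (X + _) :: _](sum_differences (last z s1) b).
        by rewrite addrC subrKA /path_mould /= pairmap_cat.
      over.
    over.
  (* The empty prefix, where the block starts at [z], gives [path_mu B A]. *)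
  rewrite cut_sum_first /path_mu /=; rewrite -addrA; congr (_ + _).
    rewrite [RHS]cut_sum_last (A0 : path_mould A [:: z] = 0) mulr0 addr0.
    by apply: eq_cut_sum => b c; apply: eq_uncons => y u; rewrite mulrC.
  rewrite addrC -cut_sumB; apply: eq_cut_sum => a v.
  case: v => [|x v] /=; first by rewrite subrr.
  (* The cut with nothing after the block is the term subtracted by [mu A B]. *)
  rewrite last_rcons [X in _ = X - _]cut_sum_last cats1 addrK.
  by apply: eq_cut_sum => b c; apply: eq_uncons => y u; rewrite cat_rcons.
rewrite [differences _]/= cut_sum_pairmap; apply: eq_cut_sum => s1 s2.
rewrite uncons_pairmap.
transitivity (uncons (fun x => cut_sum (fun b c =>
    path_mould A (z :: s1 ++ last x b :: c) * path_mould B (x :: b))) s2).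
  apply: eq_uncons => x v; rewrite cut_sum_pairmap; apply: eq_cut_sum => b c.
  rewrite [X in (X + _) :: _](sum_differences x b) subrKA.
  by rewrite /path_mould /= pairmap_cat.
(* The point kept in the path of [A] ends the path of [B]; push invariance brings it to the
   front. *)
rewrite (uncons_cut_sum (fun p c =>
  path_mould A (z :: s1 ++ last z p :: c) * path_mould B p)).
by apply: eq_cut_sum => b c; apply: eq_uncons => x v; rewrite last_rcons pushB.
Qed.

Lemma kills_path_slide A B z : ARI_al_al A -> ARI_al_al B ->
  kills_shuffles (path_slide A B z).
Proof.
move=> [_ /alternalP killA _] [_ /alternalP killB _].
apply: (@kills_cut_slide _ _ (fun b x w =>
          path_mould A (z :: w) * path_mould B (x :: b)) (fun _ x => x)).
  by move=> b x; apply: kills_shufflesZr; apply: kills_path_mould.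
by move=> a x c; apply: kills_shufflesZl; apply: kills_path_mould.
Qed.

(** The [mu] terms of the two [arit_differences] cancel [limu A B]. *)
Lemma ari_differences A B z s : ARI_al_al A -> ARI_al_al B ->
  ari A B (differences (z :: s)) =
  path_slide B A z s - path_slide A B z s + (path_mu B A z s - path_mu A B z s).
Proof.
move=> alA alB; have [[A0 _] _ _] := alA; have [[B0 _] _ _] := alB.
rewrite /ari /limu /mould_add /mould_sub.
rewrite !arit_differences // => [|q x|q x]; try exact: path_mould_push.
ring.
Qed.

Lemma kills_swap_ari A B : ARI_al_al A -> ARI_al_al B ->
  kills_shuffles (swap (ari A B)).
Proof.
move=> alA alB; have [_ /alternalP killA _] := alA.
have [_ /alternalP killB _] := alB.
apply: (@eq_kills_shuffles _ _ (fun w =>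
  path_slide B A 0 (rev w) - path_slide A B 0 (rev w) +
  (path_mu B A 0 (rev w) - path_mu A B 0 (rev w)))) => [w|].
  by rewrite -ari_differences.
apply: (kills_shuffles_rev (M := fun s => path_slide B A 0 s -
  path_slide A B 0 s + (path_mu B A 0 s - path_mu A B 0 s))).
apply: kills_shufflesD; first by apply: kills_shufflesB; apply: kills_path_slide.
(* For a fixed starting point, the difference of the [path_mu] terms is [limu] of two alternal
   functions of the remaining points. *)
exact: (kills_limu (kills_path_mould 0 killB) (kills_path_mould 0 killA)).
Qed.

(** In depth one each product has a factor at the empty word, which makes the bracket trivially even
    there. *)
Lemma ari_depth1 A B (u : U) : A [::] = 0 -> B [::] = 0 -> ari A B [:: u] = 0.
Proof.
move=> A0 B0; rewrite /ari /mould_add /mould_sub.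
rewrite !aritE // /limu /mould_sub /mu /slide.
rewrite !cut_sumB.
rewrite !(cut_sum_cons, cut_sum_nil) /= !(cut_sum_cons, cut_sum_nil) /=.
by rewrite !big_ord_recl !big_ord0 /= A0 B0; ring.
Qed.

End Moulds.

Theorem theorem2p5p6 (K : fieldType) (charK0 : [pchar K] =i pred0)
    (U : zmodType) :
  [/\ ARI_al_al (@mould0 U K),
      forall A B : mould U K,
        ARI_al_al A -> ARI_al_al B -> ARI_al_al (mould_add A B),
      forall (x : K) (A : mould U K),
        ARI_al_al A -> ARI_al_al (mould_scale x A)
    & forall A B : mould U K,
        ARI_al_al A -> ARI_al_al B -> ARI_al_al (ari A B)].
Proof.
split=> [|A B|x A|A B alA alB].
- have alt0 : alternal (@mould0 U K) by split=> // *; apply: big1.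
  by split=> //; exact: alt0.
- move=> [/alternalP killA /alternalP killsA evenA].
  move=> [/alternalP killB /alternalP killsB evenB].
  split=> [||u]; last by rewrite /mould_add evenA evenB.
    by apply/alternalP; apply: kills_shufflesD.
  by apply/alternalP; apply: (kills_shufflesD killsA killsB).
- move=> [/alternalP killA /alternalP killsA evenA].
  split=> [||u]; last by rewrite /mould_scale evenA.
    by apply/alternalP; apply: kills_shufflesZl.
  by apply/alternalP; apply: (kills_shufflesZl x killsA).
- have [/alternalP killA _ _] := alA; have [/alternalP killB _ _] := alB.
  split; [|exact/alternalP/kills_swap_ari|move=> u].
    exact/alternalP/kills_ari.
  by rewrite !ari_depth1 ?killA.1 ?killB.1.
Qed.
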